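(* For every $k\in\{1,2\}$, set of formulas $\Gamma$, and formula $\varphi$: $\Gamma\vDash_k\varphi \Rightarrow \Gamma\vdash_k\varphi$.
   Context: Formulas are built from a countable set $PL$ of propositional letters and $\bot$ using $\land,\lor,\to$; $\neg\alpha:=\alpha\to\bot$, $\top:=\bot\to\bot$. For a frame $\mathfrak F=\langle W,R\rangle$, $X\subseteq W$: $\Box_{\mathfrak F}X=\{w\mid\forall v(wRv\Rightarrow v\in X)\}$, $\Diamond_{\mathfrak F}X=W\setminus\Box_{\mathfrak F}(W\setminus X)$, $\Diamond^{-1}_{\mathfrak F}X=\{w\mid\exists x\in X,\ xRw\}$; $FP_{\mathfrak F}=\{\Box_{\mathfrak F}X\mid X\subseteq W\}$. A $\Box\Diamond^{-1}$-model is a Kripke model with $V(p)\in FP_{\mathfrak F}$ for all $p$. Truth sets: $\|p\|=V(p)$, $\|\bot\|=\Box_{\mathfrak F}\emptyset$, $\|\alpha\land\beta\|=\|\alpha\|\cap\|\beta\|$, $\|\alpha\to\beta\|=\Box_{\mathfrak F}((W\setminus\|\alpha\|)\cup\|\beta\|)$, $\|\alpha\lor\beta\|=\Box_{\mathfrak F}\Diamond^{-1}_{\mathfrak F}(\|\alpha\|\cup\|\beta\|)$. A frame is pseudo-reflexive iff every $w\in\Box_{\mathfrak F}\emptyset\cup\Diamond_{\mathfrak F}\Box_{\mathfrak F}\Diamond^{-1}_{\mathfrak F}\{w\}$, and pseudo-symmetric iff every $w\in\Box_{\mathfrak F}\Diamond_{\mathfrak F}\Box_{\mathfrak F}\Diamond^{-1}_{\mathfrak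 F}\{w\}$. $\mathcal D_1$ = pseudo-reflexive pseudo-symmetric $\Box\Diamond^{-1}$-models; $\mathcal D_2$ = reflexive pseudo-symmetric $\Box\Diamond^{-1}$-models; $\Gamma\vDash_k\varphi$ iff for every $\mathfrak M\in\mathcal D_k$ and $w$, $\mathfrak M,w\vDash\Gamma$ implies $\mathfrak M,w\vDash\varphi$. Syntax: relations $\vdash\subseteq Form\times Form$, extended to sets by $\Gamma\vdash\alpha$ iff $\bigwedge\Gamma_0\vdash\alpha$ for some finite $\Gamma_0\subseteq\Gamma$ ($\bigwedge\emptyset=\top$); ''$\vdash\alpha$'' means $\chi\vdash\alpha$ for all $\chi$. Basic rules: (A) $\alpha\vdash\alpha$; (Cut) $\alpha\vdash\beta,\beta\vdash\gamma\Rightarrow\alpha\vdash\gamma$; ($\bot$) $\bot\vdash\alpha$; ($\land$R) $\chi\vdash\alpha,\chi\vdash\beta\Rightarrow\chi\vdash\alpha\land\beta$; ($\land$L) $\alpha\land\beta\vdash\alpha$, $\alpha\land\beta\vdash\beta$; ($\lor$R) $\alpha\vdash\alpha\lor\beta$, $\beta\vdash\alpha\lor\beta$; ($\lor$L) $\alpha\vdash\chi,\beta\vdash\chi\Rightarrow\alpha\lor\beta\vdash\chi$; (DT$_0$) $\alpha\vdash\beta\Rightarrow\ \vdash\alpha\to\beta$; ($\to\land$) $(\alpha\to\beta)\land(\alpha\to\gamma)\vdash\alpha\to\beta\land\gamma$; ($\to$tr) $(\alpha\to\beta)\land(\beta\to\gamma)\vdash\alpha\to\gamma$; ($\to$-$\lor$.s)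 for $n\ge1$, $\bigvee_j(\alpha_j\to\beta_j)\land\bigwedge_j(\psi_j\land\beta_j\to\chi)\vdash\bigwedge_j(\psi_j\land\alpha_j)\to\chi$. Further rules: (Abs) $\alpha\land\neg\alpha\vdash\bot$; ($\neg\neg$I) $\alpha\vdash\neg\neg\alpha$; (Refl$_1$) if $\psi_j\land\beta_j\vdash\chi$ for all $1\le j\le n$ then $\bigwedge_j(\psi_j\land\alpha_j)\land\bigvee_j(\alpha_j\to\beta_j)\vdash\chi$; (Refl$_2$) $\bigwedge_j(\psi_j\land\beta_j\to\chi)\vdash\bigwedge_j(\psi_j\land\alpha_j)\land\bigvee_j(\alpha_j\to\beta_j)\to\chi$. i-formulas: expressions $\Delta\sqsupset\Theta$ with $\Delta,\Theta$ non-empty finite sets of formulas. $\Vdash_1\subseteq\wp(Form^i)\times Form^i$ is the least relation satisfying: (A) $\Gamma^i\cup\{\alpha^i\}\Vdash\alpha^i$; (Cut) $\Gamma^i\Vdash\alpha^i$ and $\Phi^i\cup\{\alpha^i\}\Vdash\beta^i$ imply $\Gamma^i\cup\Phi^i\Vdash\beta^i$; (i-A) $\Delta\cap\Theta\neq\emptyset\Rightarrow\ \Vdash\Delta\sqsupset\Theta$; (i-Cut) $\{\Delta_1\sqsupset\Theta_1\cup\{\varphi\},\Delta_2\cup\{\varphi\}\sqsupset\Theta_2\}\Vdash\Delta_1\cup\Delta_2\sqsupset\Theta_1\cup\Theta_2$; (i-$\land$L) $\Vdash\{\varphi\land\psi\}\sqsupset\{\varphi\}$ and $\Vdash\{\varphi\land\psi\}\sqsupset\{\psi\}$;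 (i-$\land$R) $\Vdash\{\varphi,\psi\}\sqsupset\{\varphi\land\psi\}$. For a formula $\gamma$, $\Vdash^\gamma_2$ is the least such relation also satisfying ($\gamma$-Refl) $\Vdash\{\varphi_1,\dots,\varphi_n,\bigvee_j(\varphi_j\to\psi_j)\lor\gamma\}\sqsupset\{\psi_1,\dots,\psi_n\}$. Let $i_\gamma(\Gamma)=\{\{\varphi_1,\dots,\varphi_n\}\sqsupset\{\psi_1,\dots,\psi_n\}\mid\bigvee_j(\varphi_j\to\psi_j)\lor\gamma\in\Gamma\}$ and $Th_{\vdash}(\alpha)=\{\varphi\mid\alpha\vdash\varphi\}$. $\vdash_1$ is the smallest $\vdash$ satisfying the basic rules, (Abs), ($\neg\neg$I) and (Prop$_1$): $i_\gamma(Th_\vdash(\alpha))\Vdash_1\{\top\}\sqsupset\{\bot\}\Rightarrow\alpha\vdash\gamma$. $\vdash_2$ is the smallest $\vdash$ satisfying the basic rules, ($\neg\neg$I), (Refl$_1$), (Refl$_2$) and (Prop$_2$): $i_\gamma(Th_\vdash(\alpha))\Vdash^\gamma_2\{\top\}\sqsupset\{\bot\}\Rightarrow\alpha\vdash\gamma$. *)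

(* Defs.v *)
From HB Require Import structures.
From mathcomp Require Import all_boot finmap all_classical.

Set Implicit Arguments.
Unset Strict Implicit.
Unset Printing Implicit Defensive.

Local Open Scope classical_set_scope.

Inductive form (PL : Type) : Type :=
| Var of PL
| Bot
| And of form PL & form PL
| Or of form PL & form PL
| Imp of form PL & form PL.

Arguments Bot {PL}.

Declare Scope form_scope.
Delimit Scope form_scope with form.
Bind Scope form_scope with form.
Notation "⊥" := Bot (at level 0) : form_scope.
Notation "a ⊓ b" := (And a b) (at level 40, left associativity) : form_scope.
Notation "a ⊔ b" := (Or a b) (at level 50, left associativity) : form_scope.
Notation "a ⊃ b" := (Imp a b) (at level 55, right associativity) : form_scope.
Local Open Scope form_scope.

Definition Neg {PL : Type} (a : form PL) : form PL := a ⊃ ⊥.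
Definition Top {PL : Type} : form PL := ⊥ ⊃ ⊥.

(* Iterated connectives associate to the left.  The conjunction of the empty
   family is Top; the disjunction is only ever used for non-empty families, so
   its value on the empty sequence is immaterial. *)
Definition bigand {PL : Type} (s : seq (form PL)) : form PL :=
  if s is a :: s' then foldl (@And PL) a s' else Top.
Definition bigor {PL : Type} (s : seq (form PL)) : form PL :=
  if s is a :: s' then foldl (@Or PL) a s' else ⊥.

Notation "⋀_ ( j < n ) F" := (bigand [seq F%form | j <- enum 'I_n])
  (at level 36, j name, n at level 50, F at level 36) : form_scope.
Notation "⋁_ ( j < n ) F" := (bigor [seq F%form | j <- enum 'I_n])
  (at level 36, j name, n at level 50, F at level 36) : form_scope.

(* Formulas over a countable set of letters form a countType, which makes the
   type {fset form PL} of finite sets of formulas available. *)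
Fixpoint form_encode (PL : Type) (a : form PL) : GenTree.tree PL :=
  match a with
  | Var p => GenTree.Leaf p
  | Bot => GenTree.Node 0 [::]
  | And a b => GenTree.Node 1 [:: form_encode a; form_encode b]
  | Or a b => GenTree.Node 2 [:: form_encode a; form_encode b]
  | Imp a b => GenTree.Node 3 [:: form_encode a; form_encode b]
  end.

Fixpoint form_decode (PL : Type) (t : GenTree.tree PL) : form PL :=
  match t with
  | GenTree.Leaf p => Var p
  | GenTree.Node 1 [:: t; u] => form_decode t ⊓ form_decode u
  | GenTree.Node 2 [:: t; u] => form_decode t ⊔ form_decode u
  | GenTree.Node 3 [:: t; u] => form_decode t ⊃ form_decode u
  | _ => ⊥
  end.

Lemma form_encodeK (PL : Type) : cancel (@form_encode PL) (@form_decode PL).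
Proof. by elim=> //= a -> b ->. Qed.

HB.instance Definition _ (PL : countType) :=
  Countable.copy (form PL) (can_type (@form_encodeK PL)).

Record frame : Type := Frame { world : Type; acc : world -> world -> Prop }.

Definition box (F : frame) (X : set (world F)) : set (world F) :=
  [set w | forall v, acc w v -> X v].
Definition dia (F : frame) (X : set (world F)) : set (world F) :=
  ~` box (~` X).
Definition diainv (F : frame) (X : set (world F)) : set (world F) :=
  [set w | exists x, X x /\ acc x w].

Definition FP (F : frame) : set (set (world F)) :=
  [set box X | X in [set: set (world F)]].

Definition frame_refl (F : frame) : Prop := forall w : world F, acc w w.
Definition pseudo_refl (F : frame) : Prop :=
  forall w : world F, (box set0 `|` dia (box (diainv [set w]))) w.
Definition pseudo_sym (F : frame) : Prop :=
  forall w : world F, box (dia (box (diainv [set w]))) w.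

Record bd_model (PL : Type) : Type := BdModel {
  frame_of : frame;
  val_of : PL -> set (world frame_of);
  val_FP : forall p, FP (val_of p)
}.

Arguments val_of {PL} b _.

Fixpoint truth (PL : Type) (F : frame) (V : PL -> set (world F)) (a : form PL) :
    set (world F) :=
  match a with
  | Var p => V p
  | Bot => box set0
  | And a b => truth V a `&` truth V b
  | Or a b => box (diainv (truth V a `|` truth V b))
  | Imp a b => box (~` truth V a `|` truth V b)
  end.

Inductive logic_index : Type := One | Two.

Definition model_class (PL : Type) (k : logic_index) (M : bd_model PL) : Prop :=
  match k with
  | One => pseudo_refl (frame_of M) /\ pseudo_sym (frame_of M)
  | Two => frame_refl (frame_of M) /\ pseudo_sym (frame_of M)
  end.

Definition entails (PL : Type) (k : logic_index)
    (Gamma : set (form PL)) (a : form PL) : Prop :=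
  forall M : bd_model PL, model_class k M -> forall w : world (frame_of M),
    (forall b, Gamma b -> truth (val_of M) b w) -> truth (val_of M) a w.

Record iform (PL : countType) : Type := IForm {
  ante : {fset form PL};
  conseq : {fset form PL};
  ante_neq0 : ante != fset0;
  conseq_neq0 : conseq != fset0
}.

(* In the rules below the finite sets are arbitrary, subject only to every
   displayed expression being an i-formula; in particular Theta1 and Delta2 may
   be empty in the rule ID_icut. *)
Inductive iderives (PL : countType) (Ax : set (iform PL)) :
    set (iform PL) -> iform PL -> Prop :=
| ID_ax d : Ax d -> iderives Ax set0 d
| ID_A S d : iderives Ax (S `|` [set d]) d
| ID_cut S T d e :
    iderives Ax S d -> iderives Ax (T `|` [set d]) e -> iderives Ax (S `|` T) e
| ID_iA (Delta Theta : {fset form PL}) (h : Delta != fset0) (k : Theta != fset0) :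
    (Delta `&` Theta)%fset != fset0 -> iderives Ax set0 (IForm h k)
| ID_icut (Delta1 Theta1 Delta2 Theta2 : {fset form PL}) (a : form PL)
    (h1 : Delta1 != fset0) (k1 : (Theta1 `|` [fset a])%fset != fset0)
    (h2 : (Delta2 `|` [fset a])%fset != fset0) (k2 : Theta2 != fset0)
    (h : (Delta1 `|` Delta2)%fset != fset0)
    (k : (Theta1 `|` Theta2)%fset != fset0) :
    iderives Ax [set IForm h1 k1; IForm h2 k2] (IForm h k)
| ID_andL1 (a b : form PL)
    (h : [fset a ⊓ b]%fset != fset0) (k : [fset a]%fset != fset0) :
    iderives Ax set0 (IForm h k)
| ID_andL2 (a b : form PL)
    (h : [fset a ⊓ b]%fset != fset0) (k : [fset b]%fset != fset0) :
    iderives Ax set0 (IForm h k)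
| ID_andR (a b : form PL)
    (h : [fset a; b]%fset != fset0) (k : [fset a ⊓ b]%fset != fset0) :
    iderives Ax set0 (IForm h k).

Definition gamma_refl (PL : countType) (c : form PL) : set (iform PL) :=
  [set d | exists (n : nat) (a b : 'I_n.+1 -> form PL),
    ante d = ([fset a j | j in 'I_n.+1] `|`
              [fset (⋁_(j < n.+1) (a j ⊃ b j)) ⊔ c])%fset /\
    conseq d = [fset b j | j in 'I_n.+1]%fset].

Definition iderives1 (PL : countType) : set (iform PL) -> iform PL -> Prop :=
  iderives set0.
Definition iderives2 (PL : countType) (c : form PL) :
    set (iform PL) -> iform PL -> Prop :=
  iderives (gamma_refl c).

Definition i_set (PL : countType) (c : form PL) (Gamma : set (form PL)) :
    set (iform PL) :=
  [set d | exists (n : nat) (a b : 'I_n.+1 -> form PL),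
    [/\ Gamma ((⋁_(j < n.+1) (a j ⊃ b j)) ⊔ c),
        ante d = [fset a j | j in 'I_n.+1]%fset &
        conseq d = [fset b j | j in 'I_n.+1]%fset]].

Lemma fset1_neq0 (T : choiceType) (x : T) : [fset x]%fset != fset0.
Proof. by apply/fset0Pn; exists x; rewrite inE. Qed.

Definition top_bot (PL : countType) : iform PL :=
  IForm (fset1_neq0 Top) (fset1_neq0 ⊥).

Definition Th (PL : Type) (P : form PL -> form PL -> Prop) (a : form PL) :
    set (form PL) :=
  [set b | P a b].

Definition thm (PL : Type) (P : form PL -> form PL -> Prop) (a : form PL) :
    Prop :=
  forall c, P c a.

Record basic_rules (PL : Type) (P : form PL -> form PL -> Prop) : Prop :=
  BasicRules {
  R_A : forall a, P a a;
  R_cut : forall a b c, P a b -> P b c -> P a c;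
  R_bot : forall a, P ⊥ a;
  R_andR : forall c a b, P c a -> P c b -> P c (a ⊓ b);
  R_andL1 : forall a b, P (a ⊓ b) a;
  R_andL2 : forall a b, P (a ⊓ b) b;
  R_orR1 : forall a b, P a (a ⊔ b);
  R_orR2 : forall a b, P b (a ⊔ b);
  R_orL : forall a b c, P a c -> P b c -> P (a ⊔ b) c;
  R_DT0 : forall a b, P a b -> thm P (a ⊃ b);
  R_imp_and : forall a b c, P ((a ⊃ b) ⊓ (a ⊃ c)) (a ⊃ (b ⊓ c));
  R_imp_tr : forall a b c, P ((a ⊃ b) ⊓ (b ⊃ c)) (a ⊃ c);
  R_imp_or : forall (n : nat) (a b p : 'I_n.+1 -> form PL) (c : form PL),
    P ((⋁_(j < n.+1) (a j ⊃ b j)) ⊓ (⋀_(j < n.+1) ((p j ⊓ b j) ⊃ c)))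
      ((⋀_(j < n.+1) (p j ⊓ a j)) ⊃ c)
}.

Definition rule_abs (PL : Type) (P : form PL -> form PL -> Prop) : Prop :=
  forall a, P (a ⊓ Neg a) ⊥.

Definition rule_negnegI (PL : Type) (P : form PL -> form PL -> Prop) : Prop :=
  forall a, P a (Neg (Neg a)).

Definition rule_refl1 (PL : Type) (P : form PL -> form PL -> Prop) : Prop :=
  forall (n : nat) (a b p : 'I_n.+1 -> form PL) (c : form PL),
    (forall j, P (p j ⊓ b j) c) ->
    P ((⋀_(j < n.+1) (p j ⊓ a j)) ⊓ (⋁_(j < n.+1) (a j ⊃ b j))) c.

Definition rule_refl2 (PL : Type) (P : form PL -> form PL -> Prop) : Prop :=
  forall (n : nat) (a b p : 'I_n.+1 -> form PL) (c : form PL),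
    P (⋀_(j < n.+1) ((p j ⊓ b j) ⊃ c))
      (((⋀_(j < n.+1) (p j ⊓ a j)) ⊓ (⋁_(j < n.+1) (a j ⊃ b j))) ⊃ c).

Definition rule_prop1 (PL : countType) (P : form PL -> form PL -> Prop) : Prop :=
  forall a c, iderives1 (i_set c (Th P a)) (top_bot PL) -> P a c.

Definition rule_prop2 (PL : countType) (P : form PL -> form PL -> Prop) : Prop :=
  forall a c, iderives2 c (i_set c (Th P a)) (top_bot PL) -> P a c.

Definition rules (PL : countType) (k : logic_index)
    (P : form PL -> form PL -> Prop) : Prop :=
  match k with
  | One => [/\ basic_rules P, rule_abs P, rule_negnegI P & rule_prop1 P]
  | Two => [/\ basic_rules P, rule_negnegI P, rule_refl1 P, rule_refl2 P
             & rule_prop2 P]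
  end.

Definition proves_form (PL : countType) (k : logic_index) (a b : form PL) : Prop :=
  forall P : form PL -> form PL -> Prop, rules k P -> P a b.

Definition proves (PL : countType) (k : logic_index)
    (Gamma : set (form PL)) (a : form PL) : Prop :=
  exists Gamma0 : {fset form PL},
    [set` Gamma0] `<=` Gamma /\ proves_form k (bigand (enum_fset Gamma0)) a.

(* The intersection proves_form k is itself closed under the rules, hence is the
   smallest relation satisfying them. *)
Lemma iderives_weaken (PL : countType) (Ax S T : set (iform PL)) (d : iform PL) :
  S `<=` T -> iderives Ax S d -> iderives Ax T d.
Proof.
move=> sST Sd; have -> : T = S `|` T by apply/esym/setUidPr.
exact: ID_cut Sd (ID_A _ _ _).
Qed.

Lemma i_set_sub (PL : countType) (c : form PL) (S T : set (form PL)) :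
  S `<=` T -> i_set c S `<=` i_set c T.
Proof.
by move=> sST d [n [a [b [Sd da ds]]]]; exists n, a, b; split=> //; apply: sST.
Qed.

Lemma proves_form_basic (PL : countType) (k : logic_index) :
  basic_rules (@proves_form PL k).
Proof.
have B P : rules k P -> basic_rules (PL := PL) P by case: k => -[].
split.
- by move=> a P /B bP; apply: (R_A bP).
- by move=> a b c ab bc P rP; apply: (R_cut (B _ rP) (ab _ rP) (bc _ rP)).
- by move=> a P /B bP; apply: (R_bot bP).
- by move=> c a b ca cb P rP; apply: (R_andR (B _ rP) (ca _ rP) (cb _ rP)).
- by move=> a b P /B bP; apply: (R_andL1 bP).
- by move=> a b P /B bP; apply: (R_andL2 bP).
- by move=> a b P /B bP; apply: (R_orR1 bP).
- by move=> a b P /B bP; apply: (R_orR2 bP).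
- by move=> a b c ac bc P rP; apply: (R_orL (B _ rP) (ac _ rP) (bc _ rP)).
- by move=> a b ab c P rP; apply: (R_DT0 (B _ rP) (ab _ rP)).
- by move=> a b c P /B bP; apply: (R_imp_and bP).
- by move=> a b c P /B bP; apply: (R_imp_tr bP).
- by move=> n a b p c P /B bP; apply: (R_imp_or bP).
Qed.

Lemma proves_form_rules (PL : countType) (k : logic_index) :
  rules k (@proves_form PL k).
Proof.
have B := @proves_form_basic PL k.
have sub P a : rules k P -> Th (@proves_form PL k) a `<=` Th P a.
  by move=> rP b; apply.
case: k B sub => B sub; split=> //.
- by move=> a P [_ + _ _]; apply.
- by move=> a P [_ _ + _]; apply.
- move=> a c h P rP; have [_ _ _] := rP; apply.
  by apply: iderives_weaken h; apply: i_set_sub; apply: sub.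
- by move=> a P [_ + _ _ _]; apply.
- by move=> n a b p c h P rP; have [_ _ + _ _] := rP; apply=> j; apply: h.
- by move=> n a b p c P [_ _ _ + _]; apply.
- move=> a c h P rP; have [_ _ _ _] := rP; apply.
  by apply: iderives_weaken h; apply: i_set_sub; apply: sub.
Qed.

(* Main.v *)
Require Import Defs.
From mathcomp Require Import all_boot finmap all_classical.

(** A world of the canonical model is a pair (F, I) of a theory F and an ideal I
    containing every implication a ⊃ b with a in F and b outside F; (F, I)
    sees (G, J) when F and J are disjoint.  Reading an i-formula as the clause
    "if all antecedents lie in G, so does some consequent", the theories G that
    can occur in a successor of (F, I) refuting c are the models of the clauses
    [i_set c F], so (Prop) provides them through completeness and compactness of
    the clause calculus.  All other worlds come from theories maximal among
    those avoiding a downward closed set of formulas, and each of the rules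
    (→-∨.s), (Refl1), (Refl2) says that such maximal theories satisfy the
    required clauses. *)

Set Implicit Arguments.
Unset Strict Implicit.
Unset Printing Implicit Defensive.

Local Open Scope classical_set_scope.
Local Open Scope form_scope.

(** * Theories and ideals of a relation satisfying the basic rules *)

Section Theories.
Variables (PL : countType) (P : form PL -> form PL -> Prop).
Hypothesis bP : basic_rules P.
Implicit Types (a b c d : form PL) (F I u : set (form PL)) (s : seq (form PL)).

Lemma proves_top a : P a Top.
Proof. exact: (R_DT0 bP (R_A bP _)). Qed.

Lemma and_monotone a b c d : P a c -> P b d -> P (a ⊓ b) (c ⊓ d).
Proof.
move=> ac bd; apply: (R_andR bP).
  exact: (R_cut bP (R_andL1 bP _ _) ac).
exact: (R_cut bP (R_andL2 bP _ _) bd).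
Qed.

(** Left association merges the second conjunct into the head, so the induction on the tail
    generalises the head. *)
Lemma bigand_elim s a : a \in s -> P (bigand s) a.
Proof.
case: s => // b s; rewrite /bigand; elim: s b a => [|c s IH] b a /=.
  by rewrite inE => /eqP ->; apply: (R_A bP).
rewrite inE => /orP[/eqP->|].
  by apply: (R_cut bP (IH (b ⊓ c) (b ⊓ c) _)); [rewrite mem_head|exact: (R_andL1 bP)].
rewrite inE => /orP[/eqP->|ha].
  by apply: (R_cut bP (IH (b ⊓ c) (b ⊓ c) _)); [rewrite mem_head|exact: (R_andL2 bP)].
by apply: IH; rewrite inE ha orbT.
Qed.

Lemma bigor_intro s a : a \in s -> P a (bigor s).
Proof.
case: s => // b s; rewrite /bigor; elim: s b a => [|c s IH] b a /=.
  by rewrite inE => /eqP ->; apply: (R_A bP).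
rewrite inE => /orP[/eqP->|].
  by apply: (R_cut bP _ (IH (b ⊔ c) (b ⊔ c) _)); [exact: (R_orR1 bP)|rewrite mem_head].
rewrite inE => /orP[/eqP->|ha].
  by apply: (R_cut bP _ (IH (b ⊔ c) (b ⊔ c) _)); [exact: (R_orR2 bP)|rewrite mem_head].
by apply: IH; rewrite inE ha orbT.
Qed.

Record theory F : Prop := Theory {
  theory_top : F Top;
  theory_and : forall a b, F a -> F b -> F (a ⊓ b);
  theory_up : forall a b, F a -> P a b -> F b }.

Record ideal I : Prop := Ideal {
  ideal_bot : I ⊥;
  ideal_or : forall a b, I a -> I b -> I (a ⊔ b);
  ideal_down : forall a b, I b -> P a b -> I a }.

Lemma theory_bigand F s :
  theory F -> (forall a, a \in s -> F a) -> F (bigand s).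
Proof.
move=> tF; case: s => [|b s] sF; first exact: theory_top tF.
rewrite /bigand; elim: s b sF => [|c s IH] b sF /=.
  by apply: sF; rewrite mem_head.
apply: IH => x; rewrite inE => /orP[/eqP->|xs].
  by apply: (theory_and tF); apply: sF; rewrite !inE eqxx ?orbT.
by apply: sF; rewrite !inE xs !orbT.
Qed.

Lemma ideal_bigor I s :
  ideal I -> (forall a, a \in s -> I a) -> I (bigor s).
Proof.
move=> iI; case: s => [|b s] sI; first exact: ideal_bot iI.
rewrite /bigor; elim: s b sI => [|c s IH] b sI /=.
  by apply: sI; rewrite mem_head.
apply: IH => x; rewrite inE => /orP[/eqP->|xs].
  by apply: (ideal_or iI); apply: sI; rewrite !inE eqxx ?orbT.
by apply: sI; rewrite !inE xs !orbT.
Qed.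

Lemma ideal_below c : ideal [set a | P a c].
Proof.
split=> [|a b|a b /= bc ab]; first exact: (R_bot bP).
- exact: (R_orL bP).
- exact: (R_cut bP ab bc).
Qed.

Lemma theory_Th a : theory (Th P a).
Proof.
split=> [|b c|b c ab bc]; first exact: proves_top.
- exact: (R_andR bP).
- exact: (R_cut bP ab bc).
Qed.

Lemma theory_thm F a : theory F -> thm P a -> F a.
Proof. by move=> tF ta; apply: (theory_up tF (theory_top tF) (ta _)). Qed.

(** Zorn's lemma. Maximality says that adjoining [b] to [u] reaches [Bad]; the member [p] of [u]
    responsible for it is a witness that takes the place of primeness. [Bad] is merely downward
    closed, so that it may be an ideal, the set of [a] with [F (a ⊃ c)], or the set of [a] from
    which the clause calculus derives [⊥]. *)
Lemma theory_maximal (Bad F : set (form PL)) :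
  (forall a b, Bad b -> P a b -> Bad a) ->
  theory F -> (forall a, F a -> ~ Bad a) ->
  exists u, [/\ theory u, F `<=` u, (forall a, u a -> ~ Bad a) &
    forall b, ~ u b -> exists2 p, u p & Bad (p ⊓ b)].
Proof.
move=> Bdown tF FnB.
pose good u := [/\ theory u, F `<=` u & forall a, u a -> ~ Bad a].
have [|A [[A0|[tA FA AnB]] Amax]] :=
    @Zorn_bigcup _ (fun u : set (form PL) => u = set0 \/ good u).
- move=> C CP Ctot.
  have gC X x : C X -> X x -> good X by move=> /CP [->|].
  have [[X CX [x Xx]]|nC] := pselect (exists2 X, C X & X !=set0); last first.
    left; apply/seteqP; split=> // x [X CX Xx].
    by apply: nC; exists X => //; exists x.
  right; have [tX FX XnB] := gC _ _ CX Xx; split.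
  + split; first by exists X => //; apply: theory_top tX.
    * move=> a b [Y CY Ya] [Z CZ Zb].
      have [tY _ _] := gC _ _ CY Ya; have [tZ _ _] := gC _ _ CZ Zb.
      have [YZ|ZY] := Ctot _ _ CY CZ.
        by exists Z => //; apply: (theory_and tZ) => //; apply: YZ.
      by exists Y => //; apply: (theory_and tY) => //; apply: ZY.
    * move=> a b [Y CY Ya] ab; have [tY _ _] := gC _ _ CY Ya.
      by exists Y => //; apply: (theory_up tY Ya ab).
  + by move=> a Fa; exists X => //; apply: FX.
  + by move=> a [Y CY Ya]; have [_ _] := gC _ _ CY Ya; apply.
- case: (Amax F); last by right; split.
  by rewrite A0; split=> // /(_ Top (theory_top tF)).
exists A; split=> // b nAb; apply: contrapT => nB.
(* [G] is the theory generated by [A] and [b]. If it avoided [Bad], it would contradict the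
   maximality of [A]. *)
pose G := [set d | exists2 p, A p & P (p ⊓ b) d].
have AG : A `<=` G by move=> a Aa; exists a => //; apply: (R_andL1 bP).
case: (Amax G).
  split=> // /(_ b) Gb; apply: nAb; apply: Gb.
  by exists Top; [exact: theory_top tA|exact: (R_andL2 bP)].
right; split.
- split; first exact: AG (theory_top tA).
  + move=> a d [p Ap pa] [q Aq qd]; exists (p ⊓ q).
      exact: (theory_and tA).
    apply: (R_andR bP); [apply: (R_cut bP _ pa)|apply: (R_cut bP _ qd)];
      apply: (and_monotone _ (R_A bP _)).
      exact: (R_andL1 bP).
    exact: (R_andL2 bP).
  + by move=> a d [p Ap pa] ad; exists p => //; apply: (R_cut bP pa ad).
- exact: subset_trans FA AG.
- by move=> a [p Ap pa] Ba; apply: nB; exists p => //; apply: Bdown Ba pa.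
Qed.

(* [u] satisfies every i-formula of [i_set c F]: if all its antecedents
   are in [u], so is one of its consequents. *)
Definition respects c F u : Prop :=
  forall n (a b : 'I_n.+1 -> form PL), F ((⋁_(j < n.+1) (a j ⊃ b j)) ⊔ c) ->
    (forall j, u (a j)) -> exists j, u (b j).

Definition failed_implications u (s : seq (form PL * form PL)) : Prop :=
  forall x, x \in s -> u x.1 /\ ~ u x.2.

Definition bigor_imp (s : seq (form PL * form PL)) : form PL :=
  bigor [seq x.1 ⊃ x.2 | x <- s].

(** The ideal generated by [c] and the implications that lead from [u] out of [u], used as the
    second component of worlds. For the empty list [bigor_imp s] is [⊥], which accounts for [c]
    itself. *)
Definition failure_ideal c u : set (form PL) :=
  [set d | exists2 s, failed_implications u s & P d (bigor_imp s ⊔ c)].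

Lemma bigor_imp_sub (s t : seq (form PL * form PL)) :
  {subset s <= t} -> P (bigor_imp s) (bigor_imp t).
Proof.
move=> st; have iI := ideal_below (bigor_imp t).
apply: (ideal_bigor iI) => _ /mapP[x xs ->].
by apply: bigor_intro; apply/mapP; exists x => //; apply: st.
Qed.

Lemma or_monotone a b c : P a b -> P (a ⊔ c) (b ⊔ c).
Proof.
move=> ab; apply: (R_orL bP); last exact: (R_orR2 bP).
exact: (R_cut bP ab (R_orR1 bP _ _)).
Qed.

Lemma ideal_failure c u : ideal (failure_ideal c u).
Proof.
split; first by exists [::] => //; apply: (R_bot bP).
- move=> a b [s us as_] [t ut bt]; exists (s ++ t).
    by move=> x; rewrite mem_cat => /orP[/us|/ut].
  apply: (R_orL bP); [apply: (R_cut bP as_)|apply: (R_cut bP bt)];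
    by apply: or_monotone; apply: bigor_imp_sub => x xs;
       rewrite mem_cat xs ?orbT.
- by move=> a b [s us bs] ab; exists s => //; apply: (R_cut bP ab bs).
Qed.

Lemma failure_ideal_gen c u : failure_ideal c u c.
Proof. by exists [::] => //; apply: (R_orR2 bP). Qed.

Lemma failure_ideal_imp c u a b : u a -> ~ u b -> failure_ideal c u (a ⊃ b).
Proof.
move=> ua ub; exists [:: (a, b)]; last exact: (R_orR1 bP).
by move=> x; rewrite inE => /eqP ->.
Qed.

(** By upward closure, a common element would put into [F] a disjunction of failed implications and
    [c], that is, a clause violated by [u]. *)
Lemma respects_failure c F u : theory F -> theory u -> ~ u ⊥ ->
  respects c F u -> forall a, F a -> ~ failure_ideal c u a.
Proof.
move=> tF tu ubot Fu a Fa [s us as_].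
(* Prepending the failed implication Top ⊃ ⊥ makes the family non-empty. *)
pose x0 : form PL * form PL := (Top, ⊥); pose t := x0 :: s.
have ut : failed_implications u t.
  move=> x; rewrite inE => /orP[/eqP->|/us//].
  by split=> //; apply: theory_top tu.
have tE : [seq (nth x0 t j).1 ⊃ (nth x0 t j).2 | j : 'I_(size s).+1 <- enum 'I_(size s).+1]
          = [seq x.1 ⊃ x.2 | x <- t].
  by rewrite -[in RHS](mkseq_nth x0 t) /mkseq -val_enum_ord -!map_comp.
have [||j] := Fu (size s) (fun j => (nth x0 t j).1) (fun j => (nth x0 t j).2).
- rewrite tE -/(bigor_imp t); apply: (theory_up tF Fa); apply: (R_cut bP as_).
  by apply: or_monotone; apply: bigor_imp_sub => x xs; rewrite inE xs orbT.
- by move=> j; apply: (proj1 (ut _ (mem_nth _ _))).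
- by apply: (proj2 (ut _ (mem_nth _ _))).
Qed.

(** * Clauses satisfied by maximal theories *)

Lemma maximal_witnesses (Bad u : set (form PL)) n (b : 'I_n.+1 -> form PL) :
  (forall d, ~ u d -> exists2 p, u p & Bad (p ⊓ d)) -> (forall j, ~ u (b j)) ->
  exists p : 'I_n.+1 -> form PL, forall j, u (p j) /\ Bad (p j ⊓ b j).
Proof.
move=> umax nub.
have [j|p pP] := @choice _ _ (fun j p => u p /\ Bad (p ⊓ b j)); last by exists p.
by have [p up Bp] := umax _ (nub j); exists p.
Qed.

(** If every consequent failed, the maximality witnesses [p j] would serve as the ψ_j of (→-∨.s),
    which then gives [F] an implication to [c] whose antecedent lies in [u]. *)
Lemma imp_respects F u c : theory F -> theory u ->
  (forall a, u a -> ~ F (a ⊃ c)) ->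
  (forall b, ~ u b -> exists2 p, u p & F ((p ⊓ b) ⊃ c)) ->
  respects ⊥ F u.
Proof.
move=> tF tu uF umax n a b Fab ua; apply: contrapT => nub.
have [|p pP] := maximal_witnesses (Bad := [set d | F (d ⊃ c)]) umax (b := b).
  by move=> j ubj; apply: nub; exists j.
apply: (uF (⋀_(j < n.+1) (p j ⊓ a j))).
  apply: (theory_bigand tu) => _ /mapP[j _ ->].
  by apply: (theory_and tu); [case: (pP j)|].
apply: (theory_up tF _ (R_imp_or bP _ _ _ _)); apply: (theory_and tF).
  apply: (theory_up tF Fab); apply: (R_orL bP (R_A bP _)).
  exact: (R_bot bP).
by apply: (theory_bigand tF) => _ /mapP[j _ ->]; case: (pP j).
Qed.

(** The disjunction of implications now lies in [u] and not in [F], so it joins the antecedent, and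
    (Refl2) replaces (→-∨.s). *)
Lemma imp_refl_respects F u c : rule_refl2 P -> theory F -> theory u ->
  (forall a, u a -> ~ F (a ⊃ c)) ->
  (forall b, ~ u b -> exists2 p, u p & F ((p ⊓ b) ⊃ c)) ->
  respects ⊥ u u.
Proof.
move=> r2 tF tu uF umax n a b uab ua; apply: contrapT => nub.
have [|p pP] := maximal_witnesses (Bad := [set d | F (d ⊃ c)]) umax (b := b).
  by move=> j ubj; apply: nub; exists j.
apply: (uF ((⋀_(j < n.+1) (p j ⊓ a j)) ⊓ (⋁_(j < n.+1) (a j ⊃ b j)))).
  apply: (theory_and tu).
    apply: (theory_bigand tu) => _ /mapP[j _ ->].
    by apply: (theory_and tu); [case: (pP j)|].
  by apply: (theory_up tu uab); apply: (R_orL bP (R_A bP _)); apply: (R_bot bP).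
apply: (theory_up tF _ (r2 _ _ _ _ _)).
by apply: (theory_bigand tF) => _ /mapP[j _ ->]; case: (pP j).
Qed.

Lemma ideal_refl_respects I u : rule_refl1 P -> ideal I -> theory u ->
  (forall a, u a -> ~ I a) ->
  (forall b, ~ u b -> exists2 p, u p & I (p ⊓ b)) ->
  respects ⊥ u u.
Proof.
move=> r1 iI tu uI umax n a b uab ua; apply: contrapT => nub.
have [|p pP] := maximal_witnesses umax (b := b).
  by move=> j ubj; apply: nub; exists j.
(* Closure of [I] under disjunction makes this one formula usable as the χ of (Refl1) for all
   [j]. *)
apply: (uI (⋁_(j < n.+1) (p j ⊓ b j))); last first.
  by apply: (ideal_bigor iI) => _ /mapP[j _ ->]; case: (pP j).
apply: (theory_up tu _ (r1 n a b p _ _)).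
  apply: (theory_and tu).
    apply: (theory_bigand tu) => _ /mapP[j _ ->].
    by apply: (theory_and tu); [case: (pP j)|].
  by apply: (theory_up tu uab); apply: (R_orL bP (R_A bP _)); apply: (R_bot bP).
by move=> j; apply: bigor_intro; apply/mapP; exists j; rewrite ?mem_enum.
Qed.

End Theories.

(** * Compactness and completeness of the clause calculus *)

Section IFormulas.
Variables (PL : countType) (Ax : set (iform PL)).
Local Open Scope fset_scope.

Lemma iform_eq (d e : iform PL) : ante d = ante e -> conseq d = conseq e -> d = e.
Proof.
case: d e => [X Y h k] [X' Y' h' k'] /= EX EY.
by case: _ / EX h' => h'; case: _ / EY k' => k'; congr IForm; apply: eq_irrelevance.
Qed.

Lemma iderives_mem (S : set (iform PL)) d : S d -> iderives Ax S d.
Proof.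
move=> Sd; have -> : S = (S `|` [set d])%classic.
  by apply/esym/setUidPl => x ->.
exact: ID_A.
Qed.

(** A derivation uses finitely many hypotheses. Covering by a directed family survives the
    induction: in the cut case the cut i-formula is added to every member. *)
Lemma iderives_compact (S : set (iform PL)) (d : iform PL) :
  iderives Ax S d ->
  forall (J : Type) (G : J -> set (iform PL)), J ->
    (forall i j, exists k, (G i `<=` G k)%classic /\ (G j `<=` G k)%classic) ->
    (forall x, S x -> exists i, G i x) -> exists i, iderives Ax (G i) d.
Proof.
have sub0 J (G : J -> set (iform PL)) (i : J) e :
    iderives Ax set0 e -> exists i, iderives Ax (G i) e.
  by move=> he; exists i; apply: iderives_weaken he.
elim=> {S d}.
- by move=> d Axd J G i _ _; apply: sub0 i _ _; apply: ID_ax.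
- move=> S d J G _ _ /(_ d) [|i Gid]; first by right.
  by exists i; apply: iderives_mem.
- move=> S T d e _ IH1 _ IH2 J G i0 dG ST.
  have [|i1 h1] := IH1 J G i0 dG; first by move=> x Sx; apply: ST; left.
  have [||i2 h2] := IH2 J (fun i => G i `|` [set d])%classic i0.
  + move=> i j; have [k [ik jk]] := dG i j.
    by exists k; split; apply: setSU.
  + move=> x [Tx|->]; last by exists i0; right.
    by have [i Gix] := ST x (or_intror Tx); exists i; left.
  have [k [k1 k2]] := dG i1 i2; exists k.
  rewrite -(setUid (G k)); apply: ID_cut; first exact: iderives_weaken k1 h1.
  by apply: iderives_weaken h2; apply: setSU.
- by move=> *; apply: sub0; eauto; apply: ID_iA.
- move=> X1 Y1 X2 Y2 a h1 k1 h2 k2 h k J G _ dG SG.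
  have [|i Gi] := SG (IForm h1 k1); first by left.
  have [|j Gj] := SG (IForm h2 k2); first by right.
  have [l [il jl]] := dG i j; exists l.
  apply: iderives_weaken (ID_icut Ax h1 k1 h2 k2 h k) => x [] ->.
    exact: il.
  exact: jl.
- by move=> *; apply: sub0; eauto; apply: ID_andL1.
- by move=> *; apply: sub0; eauto; apply: ID_andL2.
- by move=> *; apply: sub0; eauto; apply: ID_andR.
Qed.

Variable S : set (iform PL).
Implicit Types X Y : {fset form PL}.

(** Hiding the non-emptiness proofs lets both sides be rewritten as plain finite sets. *)
Definition clause X Y : Prop :=
  exists h k, iderives Ax S (@IForm PL X Y h k).

Lemma iderives_clause d : iderives Ax S d -> clause (ante d) (conseq d).
Proof. by case: d => X Y h k; exists h, k. Qed.

Lemma clause_iderives d : clause (ante d) (conseq d) -> iderives Ax S d.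
Proof. by move=> [h [k hk]]; rewrite (@iform_eq d (IForm h k)). Qed.

Lemma clause_axiom X Y : X `&` Y != fset0 -> clause X Y.
Proof.
move=> XY.
have h : X != fset0 by apply: contraNneq XY => ->; rewrite fset0I.
have k : Y != fset0 by apply: contraNneq XY => ->; rewrite fsetI0.
by exists h, k; apply: iderives_weaken (ID_iA Ax h k XY).
Qed.

Lemma clause_mem X Y a : a \in X -> a \in Y -> clause X Y.
Proof.
by move=> aX aY; apply: clause_axiom; apply/fset0Pn; exists a; rewrite inE aX.
Qed.

Lemma iderives_cut2 (d1 d2 e : iform PL) :
  iderives Ax S d1 -> iderives Ax S d2 -> iderives Ax [set d1; d2]%classic e ->
  iderives Ax S e.
Proof.
move=> h1 h2 he; rewrite -(setUid S); apply: (ID_cut h2).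
rewrite -(setUid S) -setUA; apply: (ID_cut h1).
by apply: iderives_weaken he => x [] ->; [right|left; right].
Qed.

Lemma clause_cut_gen X1 Y1 X2 Y2 a : X1 `|` X2 != fset0 -> Y1 `|` Y2 != fset0 ->
  clause X1 (Y1 `|` [fset a]) -> clause (X2 `|` [fset a]) Y2 ->
  clause (X1 `|` X2) (Y1 `|` Y2).
Proof.
move=> h k [h1 [k1 c1]] [h2 [k2 c2]]; exists h, k.
exact: iderives_cut2 c1 c2 (ID_icut _ _ _ _ _ _ _).
Qed.

(** Weakening is a cut on some [y] in [Y]: since [y] is also in [Y'], adding it to the antecedents
    [X'] gives an instance of (i-A). *)
Lemma clause_weaken X Y X' Y' : X `<=` X' -> Y `<=` Y' ->
  clause X Y -> clause X' Y'.
Proof.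
move=> XX' YY' [h [k c]]; have [x xX] := fset0Pn _ h; have [y yY] := fset0Pn _ k.
have EX : X `|` X' = X' by apply/fsetUidPr.
have EY : Y `|` Y' = Y' by apply/fsetUidPr.
have EYy : Y `|` [fset y] = Y by apply/fsetUidPl; rewrite fsub1set.
rewrite -EX -EY; apply: (@clause_cut_gen _ _ _ _ y).
- by apply/fset0Pn; exists x; rewrite inE xX.
- by apply/fset0Pn; exists y; rewrite inE yY.
- by rewrite EYy; exists h, k.
- by apply: (clause_mem (a := y)); rewrite ?inE ?eqxx ?orbT ?(fsubsetP YY').
Qed.

Lemma clause_cut X Y a : X != fset0 -> Y != fset0 ->
  clause X (a |` Y) -> clause (a |` X) Y -> clause X Y.
Proof.
move=> X0 Y0 c1 c2; rewrite -(fsetUid X) -(fsetUid Y).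
by apply: (@clause_cut_gen _ _ _ _ a); rewrite ?fsetUid // fsetUC.
Qed.

Lemma clause_drop_ante (q : form PL) (s : seq (form PL)) Y :
  (forall x, x \in s -> clause [fset q] [fset x]) ->
  clause (q |` [fset x in s]) Y -> clause [fset q] Y.
Proof.
elim: s => [|x s IH] sq cY.
  by apply: clause_weaken cY => //; apply/fsubsetP => y; rewrite !inE orbF.
have /fset0Pn[y yY] : Y != fset0 by case: cY => h [k _].
apply: IH => [z zs|]; first by apply: sq; rewrite inE zs orbT.
apply: (@clause_cut _ _ x).
- by apply/fset0Pn; exists q; rewrite !inE eqxx.
- by apply/fset0Pn; exists y.
- apply: clause_weaken (sq x _); last exact: mem_head.
    by apply/fsubsetP => z; rewrite !inE => ->.
  by apply/fsubsetP => z; rewrite !inE => ->.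
- apply: clause_weaken cY => //; apply/fsubsetP => z; rewrite !inE.
  by case/or3P => ->; rewrite ?orbT.
Qed.

Lemma clause_drop_conseq (q b : form PL) (s : seq (form PL)) :
  (forall x, x \in s -> clause [fset x; q] [fset b]) ->
  clause [fset q] (b |` [fset x in s]) -> clause [fset q] [fset b].
Proof.
elim: s => [|x s IH] sq cY.
  by apply: clause_weaken cY => //; apply/fsubsetP => y; rewrite !inE orbF.
apply: IH => [z zs|]; first by apply: sq; rewrite inE zs orbT.
apply: (@clause_cut _ _ x).
- exact: fset1_neq0.
- by apply/fset0Pn; exists b; rewrite !inE eqxx.
- apply: clause_weaken cY => //; apply/fsubsetP => z; rewrite !inE.
  by case/or3P => ->; rewrite ?orbT.
- apply: clause_weaken (sq x _); last exact: mem_head.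
    by apply/fsubsetP => z; rewrite !inE.
  by apply/fsubsetP => z; rewrite !inE => ->.
Qed.

Variable P : form PL -> form PL -> Prop.
Hypothesis bP : basic_rules P.

(** Take [u] maximal among the theories containing no [a] whose clause to [⊥] is derivable. A
    derivable clause violated by [u] could be cut down to a clause from a member of [u] to [⊥]. *)
Lemma iderives_complete :
  (forall a b, P a b -> clause [fset a] [fset b]) ->
  ~ iderives Ax S (top_bot PL) ->
  exists u, [/\ theory P u, ~ u ⊥ & forall d, iderives Ax S d ->
    (forall x, x \in ante d -> u x) -> exists2 y, y \in conseq d & u y].
Proof.
move=> PS ntb; pose Bad := [set a | clause [fset a] [fset ⊥]].
have Bdown a b : Bad b -> P a b -> Bad a.
  move=> cb /PS cab; apply: (@clause_cut _ _ b); rewrite ?fset1_neq0 //.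
    by apply: clause_weaken cab => //; apply: fsubsetUl.
  by apply: clause_weaken cb => //; apply: fsubsetUl.
have [|u [tu _ uB umax]] := theory_maximal bP Bdown (theory_Th bP Top).
  move=> a ta Ba; apply: ntb; by apply: clause_iderives; apply: Bdown Ba ta.
have ubot : ~ u ⊥ by move=> /uB; apply; apply: (@clause_mem _ _ ⊥); rewrite inE.
exists u; split=> // d /iderives_clause cd ud; apply: contrapT => nd.
pose q := bigand (ante d).
have uq : u q by apply: (theory_bigand tu).
have cq : clause [fset q] (conseq d).
  apply: (@clause_drop_ante q (ante d)).
    by move=> x xd; apply: PS; apply: bigand_elim.
  by apply: clause_weaken cd => //; apply/fsubsetP => x; rewrite !inE => ->; rewrite orbT.
(* The conjunction of the maximality witnesses, one per consequent, refutes all consequents at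
   once. *)
have [r ur rB] : exists2 r, u r & forall x, x \in (conseq d : seq _) -> Bad (r ⊓ x).
  have : forall x, x \in (conseq d : seq _) -> ~ u x.
    by move=> x xd ux; apply: nd; exists x.
  elim: (conseq d : seq _) => [|x s IH] sd.
    by exists Top => //; apply: theory_top tu.
  have [|r ur rs] := IH; first by move=> y ys; apply: sd; rewrite inE ys orbT.
  have [|p up Bp] := umax x; first by apply: sd; rewrite mem_head.
  exists (r ⊓ p); first exact: theory_and tu _ _ ur up.
  move=> y; rewrite inE => /orP[/eqP->|/rs By].
    by apply: Bdown Bp _; apply: (and_monotone bP (R_andL2 bP _ _) (R_A bP _)).
  by apply: Bdown By _; apply: (and_monotone bP (R_andL1 bP _ _) (R_A bP _)).
apply: (uB (q ⊓ r)); first exact: theory_and tu _ _ uq ur.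
apply: (@clause_drop_conseq _ _ (conseq d)).
  (* (i-∧R) joins [q ⊓ r] and [x] into a formula below [r ⊓ x], hence in [Bad]. *)
  move=> x xd; apply: (@clause_cut _ _ ((q ⊓ r) ⊓ x)); rewrite ?fset1_neq0 //.
  - by apply/fset0Pn; exists x; rewrite !inE eqxx.
  - apply: (@clause_weaken [fset (q ⊓ r); x] [fset (q ⊓ r) ⊓ x]).
    + by apply/fsubsetP => z; rewrite !inE orbC.
    + by apply/fsubsetP => z; rewrite !inE => ->.
    have h : [fset q ⊓ r; x] != fset0.
      by apply/fset0Pn; exists x; rewrite !inE eqxx orbT.
    exists h, (fset1_neq0 _); apply: iderives_weaken (ID_andR _ _ _) => //.
  - apply: (@clause_weaken [fset ((q ⊓ r) ⊓ x)] [fset ⊥]) => //.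
      by apply/fsubsetP => z; rewrite !inE => ->.
    apply: Bdown (rB x xd) _.
    by apply: (and_monotone bP (R_andL2 bP _ _) (R_A bP _)).
apply: (@clause_cut _ _ q).
- exact: fset1_neq0.
- by apply/fset0Pn; exists ⊥; rewrite !inE eqxx.
- apply: clause_weaken (PS _ _ (R_andL1 bP _ _)) => //.
  by apply/fsubsetP => z; rewrite !inE => ->.
- apply: clause_weaken cq; apply/fsubsetP => z; rewrite !inE => -> //.
  by rewrite orbT.
Qed.

End IFormulas.

(** * From satisfied i-formulas to [respects] *)

Lemma i_set_respects (PL : countType) (c : form PL) (F u : set (form PL)) :
  (forall d, i_set c F d ->
    (forall x, x \in ante d -> u x) -> exists2 y, y \in conseq d & u y) ->
  respects c F u.
Proof.
move=> Fu n a b Fab ua.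
have im_neq0 (f : 'I_n.+1 -> form PL) : [fset f j | j in 'I_n.+1]%fset != fset0.
  by apply/fset0Pn; exists (f ord0); apply: in_imfset.
have [||y /imfsetP[j _ ->]] := Fu (IForm (im_neq0 a) (im_neq0 b)).
- by exists n, a, b.
- by move=> x /imfsetP[j _ ->].
- by exists j.
Qed.

Lemma gamma_refl_respects (PL : countType) (c : form PL) (u : set (form PL)) :
  (forall d, gamma_refl c d ->
    (forall x, x \in ante d -> u x) -> exists2 y, y \in conseq d & u y) ->
  respects c u u.
Proof.
move=> uu n a b uab ua.
have h : ([fset a j | j in 'I_n.+1] `|`
    [fset (⋁_(j < n.+1) (a j ⊃ b j)) ⊔ c])%fset != fset0.
  by apply/fset0Pn; exists (a ord0); rewrite inE in_imfset.
have k : [fset b j | j in 'I_n.+1]%fset != fset0.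
  by apply/fset0Pn; exists (b ord0); apply: in_imfset.
have [||y /imfsetP[j _ ->]] := uu (IForm h k).
- by exists n, a, b.
- by move=> x /=; rewrite !inE => /orP[/imfsetP[j _ ->]|/eqP->].
- by exists j.
Qed.

(** * Existence of worlds of the canonical model *)

Section Canonical.
Variables (PL : countType) (k : logic_index).
Implicit Types (a b c d : form PL) (F I : set (form PL)).
Local Notation P := (@proves_form PL k).
Local Notation bP := (@proves_form_basic PL k).
Local Notation theory := (@theory PL P).
Local Notation ideal := (@ideal PL P).

(* [I] collects formulas that hold at no predecessor of the point. *)
Record point F I : Prop := Point {
  point_theory : theory F;
  point_ideal : ideal I;
  point_imp : forall a b, F a -> ~ F b -> I (a ⊃ b);
  point_bot : F ⊥ -> I Top;
  point_refl : k = Two -> forall a, F a -> ~ I a }.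

Lemma rule_negnegI_proves : rule_negnegI P.
Proof. by case: k (@proves_form_rules PL k) => -[]. Qed.

(** For [k = Two] a world must see itself; [respects_failure] with [u] in both roles provides
    this. *)
Lemma failure_point c u : theory u -> ~ u ⊥ -> (k = Two -> respects c u u) ->
  point u (failure_ideal P c u).
Proof.
move=> tu ubot uu; split=> //; first exact: (ideal_failure bP).
- by move=> a b; apply: (failure_ideal_imp bP).
- by move=> /uu ru; apply: (respects_failure bP tu tu ubot ru).
Qed.

(** This yields predecessors of a world with ideal [I], and also the world that refutes a
    non-derivable formula. *)
Lemma exists_point_avoiding F I : theory F -> ideal I ->
  (forall a, F a -> ~ I a) ->
  exists G J, [/\ point G J, F `<=` G & forall a, G a -> ~ I a].
Proof.
move=> tF iI FI; have [k1|k2] : k = One \/ k = Two by case: k; [left|right].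
  (* The full ideal makes a world without predecessors, which is allowed when worlds need not see
     themselves. *)
  exists F, setT; split=> //; by split=> //; rewrite k1.
have [u [tu Fu uI umax]] := theory_maximal bP (ideal_down iI) tF FI.
exists u, (failure_ideal P ⊥ u); split=> //; apply: failure_point => //.
  by move=> /uI; apply; apply: ideal_bot iI.
move=> _; apply: (ideal_refl_respects bP _ iI) => //.
by move: (@proves_form_rules PL k); rewrite k2 => -[].
Qed.

(** Take a theory maximal against the formulas [a] with [F (a ⊃ c)]. It omits [c] because [c ⊃ c]
    lies in [F]. *)
Lemma exists_successor_imp F F0 c : theory F -> theory F0 ->
  (forall a, F0 a -> ~ F (a ⊃ c)) ->
  exists G J, [/\ point G J, F0 `<=` G, ~ G c & forall a, F a -> ~ J a].
Proof.
move=> tF tF0 F0F.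
have down a b : F (b ⊃ c) -> P a b -> F (a ⊃ c).
  move=> Fbc ab; apply: (theory_up tF _ (R_imp_tr bP a b c)).
  by apply: (theory_and tF) => //; apply: (theory_thm tF (R_DT0 bP ab)).
have [u [tu F0u uF umax]] :=
  theory_maximal bP (Bad := [set a | F (a ⊃ c)]) down tF0 F0F.
have uc : ~ u c.
  by move=> /uF; apply; apply: (theory_thm tF (R_DT0 bP (R_A bP c))).
have ubot : ~ u ⊥.
  by move=> ub; apply: uc; apply: (theory_up tu ub (R_bot bP c)).
exists u, (failure_ideal P ⊥ u); split=> //.
- apply: failure_point => // k2; apply: (imp_refl_respects bP _ tF tu uF umax).
  by move: (@proves_form_rules PL k); rewrite k2 => -[].
- exact: (respects_failure bP tF tu ubot (imp_respects bP tF tu uF umax)).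
Qed.

(** The clauses of [F] are the union of those of [Th P a] for [a] in [F], directed by conjunction.
    Compactness thus reduces [F] to one formula [a], where (Prop) applies. *)
Lemma i_set_consistent F c (Ax : set (iform PL)) :
  (forall a, iderives Ax (i_set c (Th P a)) (top_bot PL) -> P a c) ->
  theory F -> ~ F c -> ~ iderives Ax (i_set c F) (top_bot PL).
Proof.
move=> prop tF nFc /iderives_compact.
case/(_ {a | F a} (fun x => i_set c (Th P (sval x)))).
- by exists Top; apply: theory_top tF.
- move=> [a Fa] [b Fb]; exists (exist _ (a ⊓ b) (theory_and tF Fa Fb)).
  by split; apply: i_set_sub => d /= pd; apply: (R_cut bP _ pd);
    [exact: (R_andL1 bP)|exact: (R_andL2 bP)].
- move=> d [n [a [b [Fab da db]]]]; exists (exist _ _ Fab).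
  by exists n, a, b; split=> //; apply: (R_A bP).
- by move=> [a Fa] /= /prop ac; apply: nFc; apply: (theory_up tF Fa ac).
Qed.

(** The implication [a ⊃ b] is a theorem, so the one-element family (index bound [0.+1]) yields a
    member of [i_set c F]. *)
Lemma i_set_clause F c Ax a b : theory F -> P a b ->
  clause Ax (i_set c F) [fset a]%fset [fset b]%fset.
Proof.
move=> tF ab; exists (fset1_neq0 a), (fset1_neq0 b).
apply: iderives_mem; exists 0, (fun=> a), (fun=> b); split=> /=.
- rewrite enum_ordSl /= enum_ord0 /=.
  apply: (theory_up tF _ (R_orR1 bP _ _)).
  exact: (theory_thm tF (R_DT0 bP ab)).
- by apply/fsetP => x; rewrite inE; apply/eqP/imfsetP => [->|[]//]; exists ord0.
- by apply/fsetP => x; rewrite inE; apply/eqP/imfsetP => [->|[]//]; exists ord0.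
Qed.

(** With [c] in its ideal, the successor has no predecessor containing [c]. For [k = Two] the axioms
    (γ-Refl) hold in [u] and make the new world reflexive. *)
Lemma exists_successor_refuting F c : theory F -> ~ F c ->
  exists G J, [/\ point G J, J c & forall a, F a -> ~ J a].
Proof.
move=> tF nFc; pose Ax := if k is Two then gamma_refl c else set0.
have prop a : iderives Ax (i_set c (Th P a)) (top_bot PL) -> P a c.
  by rewrite /Ax; case: k (@proves_form_rules PL k) => -[]; auto.
have [a b|u [tu ubot uS]] :=
  iderives_complete bP _ (i_set_consistent prop tF nFc).
  exact: i_set_clause.
exists u, (failure_ideal P c u); split.
- apply: failure_point => // k2; apply: gamma_refl_respects => d hd.
  apply: uS; apply: (@iderives_weaken _ _ set0) => //.
  by apply: ID_ax; rewrite /Ax k2.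
- exact: (failure_ideal_gen bP).
- apply: (respects_failure bP tF tu ubot); apply: i_set_respects => d hd.
  exact: uS (iderives_mem _ hd).
Qed.

(** * The canonical frame and the truth lemma *)

Definition canonical_world : Type :=
  {FI : set (form PL) * set (form PL) | point FI.1 FI.2}.

Definition canonical_frame : frame :=
  @Frame canonical_world
    (fun w v => forall a, (sval w).1 a -> ~ (sval v).2 a).

Definition canonical_set a : set (world canonical_frame) :=
  [set w : canonical_world | (sval w).1 a].

Lemma canonical_set_closed a :
  canonical_set a = box (diainv (canonical_set a)).
Proof.
apply/seteqP; split=> [w wa v wv|w wa]; first by exists w.
apply: contrapT => nwa.
have [G [J [pt Ja wJ]]] := exists_successor_refuting (point_theory (svalP w)) nwa.
by have [x [xa /(_ _ xa)]] := wa (exist _ (G, J) pt) wJ; apply.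
Qed.

Definition canonical_model : bd_model PL :=
  @BdModel PL canonical_frame (fun p => canonical_set (Var p))
    (fun p => ex_intro2 _ _ (diainv (canonical_set (Var p))) I
       (esym (canonical_set_closed (Var p)))).

(** A theory containing [⊥] comes with an ideal containing [Top], which meets every theory. *)
Lemma canonical_acc_bot (w v : world canonical_frame) : acc w v -> ~ (sval v).1 ⊥.
Proof.
move=> wv vb; apply: (wv Top); first exact: theory_top (point_theory (svalP w)).
exact: (point_bot (svalP v) vb).
Qed.

Lemma canonical_imp a b :
  canonical_set (a ⊃ b) = box (~` canonical_set a `|` canonical_set b).
Proof.
apply/seteqP; split=> [w wab v wv|w wab].
  have [va|nva] := pselect (canonical_set a v); last by left.
  right; apply: contrapT => nvb; apply: (wv _ wab).
  exact: (point_imp (svalP v) va nvb).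
apply: contrapT => nwab.
have tw := point_theory (svalP w).
have [|G [J [pt aG nGb wJ]]] :=
    exists_successor_imp (F0 := Th P a) (c := b) tw (theory_Th bP a).
  move=> d ad wdb; apply: nwab; apply: (theory_up tw _ (R_imp_tr bP a d b)).
  by apply: (theory_and tw) => //; apply: (theory_thm tw (R_DT0 bP ad)).
have [] := wab (exist _ (G, J) pt) wJ; last exact: nGb.
by apply; apply: aG; apply: (R_A bP).
Qed.

(** Ideals do the work of prime theories: if neither disjunct held at a predecessor of [v], both
    would lie in the ideal of [v], and so would [a ⊔ b]. *)
Lemma canonical_or a b :
  canonical_set (a ⊔ b) = box (diainv (canonical_set a `|` canonical_set b)).
Proof.
apply/seteqP; split=> [w wab v wv|w wab].
  have iv := point_ideal (svalP v).
  have pred c : ~ (sval v).2 c -> exists x, canonical_set c x /\ acc x v.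
    move=> nvc; have [d cd vd|G [J [pt cG Gv]]] :=
      exists_point_avoiding (theory_Th bP c) iv.
      by apply: nvc; apply: (ideal_down iv vd cd).
    exists (exist _ (G, J) pt); split; last exact: Gv.
    by apply: cG; apply: (R_A bP).
  have [va|nva] := pselect ((sval v).2 a); last first.
    by have [x [xa xv]] := pred _ nva; exists x; split=> //; left.
  have [vb|nvb] := pselect ((sval v).2 b); last first.
    by have [x [xb xv]] := pred _ nvb; exists x; split=> //; right.
  by case: (wv _ wab); apply: (ideal_or iv va vb).
rewrite canonical_set_closed => v /wab [x [xab xv]].
exists x; split=> //; have tx := point_theory (svalP x).
by case: xab => xa; apply: (theory_up tx xa);
  [exact: (R_orR1 bP)|exact: (R_orR2 bP)].
Qed.

Lemma canonical_bot : canonical_set ⊥ = box set0.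
Proof.
apply/seteqP; split=> [w wb v wv|w w0].
  by apply: (wv _ wb); apply: (ideal_bot (point_ideal (svalP v))).
by rewrite canonical_set_closed => v /w0.
Qed.

Lemma canonical_truth a : truth (val_of canonical_model) a = canonical_set a.
Proof.
elim: a => [p||a IHa b IHb|a IHa b IHb|a IHa b IHb] //=.
- by rewrite canonical_bot.
- rewrite IHa IHb; apply/seteqP; split=> [w [wa wb]|w wab].
    exact: (theory_and (point_theory (svalP w)) wa wb).
  have tw := point_theory (svalP w).
  by split; apply: (theory_up tw wab); [exact: (R_andL1 bP)|exact: (R_andL2 bP)].
- by rewrite IHa IHb canonical_or.
- by rewrite IHa IHb canonical_imp.
Qed.

(* A world with a larger theory has fewer successors. *)
Lemma canonical_dia (v w : world canonical_frame) :
  (forall a, (sval w).1 a -> ~ (sval v).1 (Neg a)) ->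
  dia (box (diainv [set w])) v.
Proof.
move=> wv; have [G [J [pt wG _ vJ]]] :=
  exists_successor_imp (point_theory (svalP v)) (point_theory (svalP w)) wv.
move=> /(_ (exist _ (G, J) pt) vJ); apply=> x Gx; exists w; split=> //.
by move=> a /wG; apply: Gx.
Qed.

(** If [w] contains [a], it contains the double negation. A successor [v] containing [Neg a] omits
    [⊥], so it would have that double negation in its ideal. *)
Lemma canonical_pseudo_sym : pseudo_sym canonical_frame.
Proof.
move=> w v wv; apply: canonical_dia => a wa va.
have tw := point_theory (svalP w).
have wnn := theory_up tw wa (rule_negnegI_proves a).
apply: (wv _ wnn); apply: (point_imp (svalP v) va).
exact: canonical_acc_bot wv.
Qed.

Lemma canonical_class : model_class k canonical_model.
Proof.
have sym := canonical_pseudo_sym.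
have [k1|k2] : k = One \/ k = Two by case: k; [left|right].
  rewrite [X in model_class X]k1; split=> // w.
  have tw := point_theory (svalP w).
  have [wb|nwb] := pselect (canonical_set ⊥ w).
    by left; rewrite -canonical_bot.
  (* [canonical_dia] is applied with both worlds equal to [w]: by (Abs), [a] and [Neg a] in [w]
     would give [⊥]. *)
  right; apply: canonical_dia => a wa wna; apply: nwb.
  apply: (theory_up tw (theory_and tw wa wna)).
  by case: k k1 (@proves_form_rules PL k) => // _ -[].
rewrite [X in model_class X]k2; split=> // w.
exact: (point_refl (svalP w) k2).
Qed.

(** * The theory of a set of formulas and completeness *)

Lemma theory_proves (Gamma : set (form PL)) : theory [set a | proves k Gamma a].
Proof.
have sub (X Y : {fset form PL}) : (X `<=` Y)%fset ->
    P (bigand (enum_fset Y)) (bigand (enum_fset X)).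
  move=> XY; apply: (theory_bigand (theory_Th bP _)) => x xX.
  by apply: (bigand_elim bP); apply: (fsubsetP XY).
split=> [|a b [X [XG Xa]] [Y [YG Yb]]|a b [X [XG Xa]] ab].
- exists fset0; split; first by move=> x; rewrite /= inE.
  exact: (proves_top bP).
- exists (X `|` Y)%fset; split.
    by move=> x /=; rewrite inE => /orP[/XG|/YG].
  apply: (R_andR bP); [apply: (R_cut bP _ Xa)|apply: (R_cut bP _ Yb)];
    by apply: sub; rewrite ?fsubsetUl ?fsubsetUr.
- by exists X; split=> //; apply: (R_cut bP Xa ab).
Qed.

End Canonical.

Theorem theorem3 (PL : countType) (k : logic_index)
    (Gamma : set (form PL)) (phi : form PL) :
  entails k Gamma phi -> proves k Gamma phi.
Proof.
move=> ent; apply: contrapT => nG.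
have bP := @proves_form_basic PL k; have tG := theory_proves k Gamma.
(* The world sought contains all consequences of [Gamma] and no formula below [phi], in particular
   not [phi]. *)
have [a Ga aphi|F [J [pt GF Fphi]]] :=
    exists_point_avoiding tG (ideal_below bP phi).
  by apply: nG; apply: (theory_up tG Ga aphi).
have := ent _ (canonical_class PL k) (exist _ (F, J) pt).
rewrite canonical_truth; case/(_ _)/Fphi => [b Gb|]; last exact: (R_A bP).
rewrite canonical_truth; apply: GF; exists [fset b]%fset; split.
  by move=> x; rewrite /= inE => /eqP ->.
by apply: (bigand_elim bP); rewrite inE.
Qed.
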